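(* Let $G$ be a split graph with a split partition $(K,I)$ such that $I$ is a maximal independent set. Then $G$ is CDC if and only if the following two conditions hold. (1) $G$ (with the split partition $(K,I)$) has the Sperner-private (SP) property. (2) If $K$ is a maximal clique in $G$, then $G$ (with the split partition $(K,I)$) is $2$-well-dominated.
   Context: All graphs are finite, simple, undirected, with nonempty vertex set. A clique (independent set) is a set of pairwise adjacent (pairwise non-adjacent) vertices; it is maximal if it is not contained in a larger one. A split partition of a graph $G$ is a pair $(K,I)$ such that $K$ is a clique, $I$ is an independent set, $K\cap I=\emptyset$ and $K\cup I=V(G)$; $G$ is split if it has a split partition. For a vertex $v$, $N_G(v)$ is its set of neighbors; for $S\subseteq V(G)$, $N_G(S)$ is the set of vertices in $V(G)\setminus S$ having a neighbor in $S$. Let $\mathcal{H}=(V,E)$ be a finite set $V$ together with a set $E$ of subsets of $V$ (hyperedges). A family $F\subseteq E$ is Sperner if no member of $F$ contains another. $\mathcal{H}$ has the Sperner-private (SP) property if for every inclusion-wise maximal subfamily $F\subseteq E$ that is Sperner there exists a collection of vertices $(v_f : f\in F)$ in $V$ such that for all $f\in F$ we have $\{e\in F : v_f\in e\}=\{f\}$. A split graph $G$ with a split partition $(K,I)$ has the SP property if $(I,\{N_G(v)\cap I : v\in K\})$ has the SP property; it is $2$-well-dominated if all inclusion-wise minimal subsets $S\subseteq I$ such that $K\subseteq N_G(S)$ have size two. A clique transversal of a graph is a set of vertices containing at least one vertex from each maximal clique; it is minimal if it contains no smaller clique transversal. A hypergraph is conformal if every set of vertices such that any two of them belong to a common hyperedge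 is itself contained in a hyperedge. A graph $G$ is clique dually conformal (CDC) if the hypergraph with vertex set $V(G)$ whose hyperedges are the minimal clique transversals of $G$ is conformal. *)

(* Defs.v *)
From mathcomp Require Import all_boot.

Set Implicit Arguments.
Unset Strict Implicit.
Unset Printing Implicit Defensive.

(* A graph is an adjacency relation [e] on a finite type [T]; simplicity,
   i.e. [symmetric e] and [irreflexive e], is assumed where it is needed. *)
Section Graphs.
Variables (T : finType) (e : rel T).
Implicit Types (S K I : {set T}).

Definition clique S : bool :=
  [forall x in S, forall y in S, (x != y) ==> e x y].

Definition independent S : bool :=
  [forall x in S, forall y in S, (x != y) ==> ~~ e x y].

Definition split_partition K I : bool :=
  [&& clique K, independent I, K :&: I == set0 & K :|: I == [set: T]].

Definition neighbors (v : T) : {set T} := [set u | e v u].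

Definition set_neighbors S : {set T} :=
  [set v | (v \notin S) && [exists u in S, e v u]].

Definition clique_transversal S : bool :=
  [forall (C : {set T} | maxset clique C), S :&: C != set0].

End Graphs.

(* A hypergraph is given by its vertex set [V] and its hyperedge set [E],
   both inside an ambient finite type. *)
Section Hypergraphs.
Variable T : finType.
Implicit Types (V : {set T}) (E F : {set {set T}}).

Definition sperner F : bool :=
  [forall f in F, forall g in F, (f \subset g) ==> (f == g)].

Definition SP_hypergraph V E : Prop :=
  forall F, maxset (fun F' => (F' \subset E) && sperner F') F ->
  exists v : {f : {set T} | f \in F} -> T,
    forall f, v f \in V /\ [set g in F | v f \in g] = [set val f].

Definition conformal V E : Prop :=
  forall U : {set T}, U \subset V ->
  (forall x y, x \in U -> y \in U -> x != y ->
     exists2 h, h \in E & (x \in h) && (y \in h)) ->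
  exists2 h, h \in E & U \subset h.

End Hypergraphs.

Section SplitGraphs.
Variables (T : finType) (e : rel T).
Implicit Types (K I : {set T}).

Definition SP_split K I : Prop :=
  SP_hypergraph I [set neighbors e v :&: I | v in K].

Definition two_well_dominated K I : Prop :=
  forall S : {set T},
  minset (fun S' => (S' \subset I) && (K \subset set_neighbors e S')) S ->
  #|S| = 2.

Definition CDC : Prop :=
  conformal [set: T] [set S | minset (clique_transversal e) S].

End SplitGraphs.

(* Main.v *)
Require Import Defs.
From mathcomp Require Import all_boot.

(** Write a clique transversal [X] of [G] as a part [A] in [K] and a part [B]
    in [I]. Since the maximal cliques are the closed neighborhoods of the
    vertices of [I] and, when it is maximal, [K] itself ([transversalP]), [X]
    is a minimal transversal exactly when [B] consists of all the vertices of
    [I] with no neighbor in [A] and every vertex of [A] has a neighbor in [I]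
    that no other vertex of [A] sees; when [K] is a maximal clique, [A] must
    also be nonempty. So the minimal transversals are parametrized by the
    cores of [is_core], and lying in a common minimal transversal becomes a
    statement about cores ([extendableP]). As [I] is a maximal independent
    set, each vertex of [K] has a neighbor in [I] and is a core on its own.

    Two vertices of [K] lie in a common minimal transversal iff their
    neighborhoods in [I] are incomparable, and a vertex of [K] and one of [I]
    do iff they are not adjacent. Two vertices of [I] always do if [K] is not
    a maximal clique, and otherwise do iff they have a common non-neighbor in
    [K]. Larger sets behave in the same way, with two exceptions, which are
    therefore the only obstructions to conformality:
    - a set of vertices of [K] with pairwise incomparable neighborhoods need
      not have private neighbors; that it always does is the SP property
      ([SP_splitP]);
    - when [K] is a maximal clique, a subset of [I] whose pairs all miss some
      vertex of [K] may still dominate [K]; excluding this is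
      2-well-domination ([two_well_dominatedP]). *)

Set Implicit Arguments.
Unset Strict Implicit.
Unset Printing Implicit Defensive.

Section SplitTransversals.
Variables (T : finType) (e : rel T) (K I : {set T}).
Hypotheses (e_sym : symmetric e) (e_irr : irreflexive e).
Hypothesis splitKI : split_partition e K I.
Implicit Types (A P Q S U X : {set T}).

(** * Maximal cliques and clique transversals *)

Lemma in_indep_part x : (x \in I) = (x \notin K).
Proof.
case/and4P: splitKI => _ _ /eqP KI0 /eqP KIT.
have := in_setT x; rewrite -KIT inE; have := in_set0 x; rewrite -KI0 inE.
by case: (x \in K); case: (x \in I).
Qed.

Lemma clique_part_adj x y : x \in K -> y \in K -> x != y -> e x y.
Proof.
case/and4P: splitKI => /forall_inP clK _ _ _ xK yK.
by have /forall_inP/(_ y yK)/implyP := clK x xK.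
Qed.

Lemma indep_part_nadj x y : x \in I -> y \in I -> e x y = false.
Proof.
case/and4P: splitKI => _ /forall_inP indI _ _ xI yI.
have [->|xy] := eqVneq x y; first exact: e_irr.
by apply/negbTE; have /forall_inP/(_ y yI)/implyP/(_ xy) := indI x xI.
Qed.

Lemma closed_neighbors_maxclique i :
  i \in I -> maxset (clique e) (i |: neighbors e i).
Proof.
move=> iI.
have nbK x : e i x -> x \in K.
  by move=> ix; apply: contraTT ix; rewrite -in_indep_part => /(indep_part_nadj iI)->.
apply/maxsetP; split=> [|C /forall_inP clC sNC].
  apply/forall_inP=> x; rewrite !inE => xN; apply/forall_inP=> y; rewrite !inE => yN.
  apply/implyP; case/predU1P: xN => [->|ix]; case/predU1P: yN => [->|iy] //.
  - by rewrite eqxx.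
  - by rewrite e_sym.
  - by apply: clique_part_adj; apply: nbK.
apply/eqP; rewrite eqEsubset sNC andbT; apply/subsetP=> x xC.
rewrite !inE; case: eqVneq => //= xi.
have iC : i \in C by apply: (subsetP sNC); rewrite !inE eqxx.
by have /forall_inP/(_ x xC)/implyP := clC i iC; rewrite eq_sym; apply.
Qed.

(** Each maximal clique other than [K] contains a vertex [i] of [I], hence is
    the closed neighborhood of [i]; apart from [i], it lies in [K]. *)
Lemma transversalP X :
  reflect ((forall i, i \in I -> i \notin X ->
              exists a, [/\ a \in X, a \in K & e a i]) /\
           (maxset (clique e) K -> exists2 a, a \in X & a \in K))
          (clique_transversal e X).
Proof.
apply: (iffP forall_inP) => [trX | [trI trK] C maxC].
  split=> [i iI iX | maxK]; last first.
    by have /set0Pn[a] := trX K maxK; rewrite inE => /andP[]; exists a.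
  have /set0Pn[a] := trX _ (closed_neighbors_maxclique iI).
  rewrite !inE => /andP[aX /predU1P[ai|ia]]; first by rewrite -ai aX in iX.
  exists a; split; rewrite 1?e_sym //.
  by apply: contraTT ia; rewrite -in_indep_part => /(indep_part_nadj iI)->.
have /maxsetP[clC maxC'] := maxC.
have [sCK|] := boolP (C \subset K).
  have clK : clique e K by case/and4P: splitKI.
  rewrite -(maxC' K clK sCK) in maxC *.
  by have [a aX aK] := trK maxC; apply/set0Pn; exists a; rewrite inE aX.
case/subsetPn=> i iC; rewrite -in_indep_part => iI.
have sCN : C \subset i |: neighbors e i.
  apply/subsetP=> x xC; rewrite !inE; case: eqVneq => //= xi.
  by move/forall_inP/(_ i iC)/forall_inP/(_ x xC)/implyP: clC; rewrite eq_sym; apply.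
have /maxsetp clN := closed_neighbors_maxclique iI.
rewrite -(maxC' _ clN sCN); apply/set0Pn.
have [iX|iX] := boolP (i \in X); first by exists i; rewrite !inE iX eqxx.
have [a [aX _ ai]] := trI i iI iX.
by exists a; rewrite !inE aX e_sym ai orbT.
Qed.

(** * Cores of minimal transversals *)

Definition irredundant A :=
  forall a, a \in A -> exists2 i, i \in I & {in A, forall b, e b i = (b == a)}.

(** The last condition makes the transversal meet [K] when [K] is itself one of
    the cliques to meet. *)
Definition is_core A :=
  [/\ A \subset K, irredundant A & maxset (clique e) K -> A != set0].

Definition core_transversal A := A :|: [set i in I | [forall a in A, ~~ e a i]].

(** A vertex of [A] cannot be removed because of the closed neighborhood of its
    private neighbor, and a vertex of [I] because of its own. *)
Lemma core_transversal_min A :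
  is_core A -> minset (clique_transversal e) (core_transversal A).
Proof.
case=> sAK irrA neA; apply/minsetP; split=> [|Y /transversalP[trY _] sYX].
  apply/transversalP; split=> [i iI | /neA/set0Pn[a aA]]; last first.
    by exists a; rewrite ?inE ?aA ?(subsetP sAK).
  rewrite !inE iI /= => /norP[_ /forall_inPn[a aA /negPn ai]].
  by exists a; rewrite !inE aA (subsetP sAK).
have YA a : a \in Y -> a \in K -> a \in A.
  by move=> aY aK; have:= subsetP sYX a aY; rewrite !inE in_indep_part aK orbF.
apply/eqP; rewrite eqEsubset sYX; apply/subsetP=> x.
rewrite !inE => /orP[xA | /andP[xI /forall_inP nAx]].
  have [i iI privi] := irrA x xA.
  have iY : i \notin Y.
    apply/negP=> /(subsetP sYX); rewrite !inE => /orP[/(subsetP sAK)|].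
      by apply/negP; rewrite -in_indep_part.
    by case/andP=> _ /forall_inP/(_ x xA); rewrite privi ?eqxx.
  have [a [aY aK]] := trY i iI iY.
  by rewrite privi ?YA // => /eqP<-.
apply: contraT => xY; have [a [aY aK ax]] := trY x xI xY.
by have := nAx a (YA a aY aK); rewrite ax.
Qed.

Hypothesis maxI : maxset (independent e) I.

Lemma clique_part_neighbor k : k \in K -> exists2 i, i \in I & e k i.
Proof.
move=> kK; apply/exists_inP; apply: contraT; rewrite negb_exists_in => /forall_inP nkI.
case/maxsetP: maxI => _ /(_ (k |: I)) max_kI.
have indep_kI : independent e (k |: I).
  apply/forall_inP=> x /setU1P xkI; apply/forall_inP=> y /setU1P ykI.
  apply/implyP; case: xkI => [->|xI]; case: ykI => [->|yI].
  - by rewrite eqxx.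
  - by rewrite nkI.
  - by rewrite e_sym nkI.
  - by rewrite indep_part_nadj.
have := setU11 k I; rewrite max_kI ?subsetUr //.
by rewrite in_indep_part kK.
Qed.

(** Any neighbor of [k] in [I] is private when [k] is alone. *)
Lemma is_core1 k : k \in K -> is_core [set k].
Proof.
move=> kK; split=> [|a /set1P-> |_]; first by rewrite sub1set.
  have [i iI ki] := clique_part_neighbor kK.
  by exists i => // b /set1P->; rewrite ki eqxx.
by apply/set0Pn; exists k; rewrite inE.
Qed.

(** If [a] in [K] had no private neighbor, or [i] in [I] had a neighbor in the
    core, then removing that vertex would leave a transversal. *)
Lemma min_transversal_core X :
  minset (clique_transversal e) X ->
  is_core (X :&: K) /\ {in X :&: I & X :&: K, forall i a, ~~ e a i}.
Proof.
case/minsetP=> /transversalP[trI trK] minX.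
have nottr x : x \in X -> ~ clique_transversal e (X :\ x).
  move=> xX trXx; have := minX _ trXx (subsetDl _ _).
  by move/setP/(_ x); rewrite !inE eqxx xX.
split; last first.
  move=> i a; rewrite !inE => /andP[iX iI] /andP[aX aK]; apply/negP=> ai.
  have neqi b : b \in K -> b != i.
    by apply: contraTneq => ->; rewrite -in_indep_part.
  apply: (nottr i iX); apply/transversalP; split=> [j jI | /trK[b bX bK]]; last first.
    by exists b; rewrite // !inE neqi.
  rewrite !inE negb_and negbK => /predU1P[->|jX].
    by exists a; rewrite !inE neqi.
  have [b [bX bK bj]] := trI j jI jX.
  by exists b; rewrite !inE neqi.
split=> [|a|]; first exact: subsetIr; last first.
  by move=> /trK[a aX aK]; apply/set0Pn; exists a; rewrite inE aX.
rewrite inE => /andP[aX aK].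
have [/exists_inP[i iI /forall_inP privi]|] := boolP
  [exists i in I, [forall b in X :&: K, e b i == (b == a)]].
  by exists i => // b bXK; apply/eqP/privi.
rewrite negb_exists_in => /forall_inP nopriv; case: (nottr a aX).
have neqa i : i \in I -> i != a.
  by apply: contraTneq => ->; rewrite in_indep_part aK.
(* A neighbor of [a] in [I] is not private, which provides a second vertex
   of the core. *)
apply/transversalP; split=> [i iI | maxK]; last first.
  have [i iI ai] := clique_part_neighbor aK.
  have /forall_inPn[b /setIP[bX bK]] := nopriv i iI.
  have [->|ba _] := eqVneq b a; first by rewrite ai.
  by exists b; rewrite // !inE ba.
rewrite !inE neqa //= => iX.
have [c [cX cK ci]] := trI i iI iX.
have [ca|ca] := eqVneq c a; last by exists c; rewrite !inE ca.
have /forall_inPn[b /setIP[bX bK]] := nopriv i iI.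
have [->|ba] := eqVneq b a; first by rewrite -ca ci.
by rewrite eqbF_neg negbK => bi; exists b; rewrite !inE ba.
Qed.

(** Conformality quantifies over sets lying in a minimal transversal. Describing
    them through a core that only has to contain [U :&: K] leaves room for a
    core with one vertex when [U] lies in [I]. *)
Lemma extendableP U :
  (exists2 X, X \in [set S | minset (clique_transversal e) S] & U \subset X) <->
  (exists A, [/\ is_core A, U :&: K \subset A
               & {in U :&: I & A, forall i a, ~~ e a i}]).
Proof.
split=> [[X] | [A [coreA sUA nadj]]].
  rewrite inE => /min_transversal_core[coreX nadj] sUX.
  exists (X :&: K); split=> //; first exact: setSI.
  by move=> i a iUI; apply: nadj; apply: (subsetP (setSI I sUX)).
exists (core_transversal A); first by rewrite inE core_transversal_min.
apply/subsetP=> x xU; rewrite !inE; have [xI|xK] := boolP (x \in I).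
  apply/orP; right; apply/forall_inP=> a aA.
  by apply: nadj; rewrite // inE xU.
by rewrite (subsetP sUA) // inE xU; move: xK; rewrite in_indep_part negbK.
Qed.

(** * The SP property *)

Definition incomparable P :=
  {in P &, forall a b,
     neighbors e a :&: I \subset neighbors e b :&: I -> a = b}.

Lemma irredundant_incomparable A : irredundant A -> incomparable A.
Proof.
move=> irrA a b aA bA sab; have [i iI privi] := irrA a aA.
have : i \in neighbors e a :&: I by rewrite !inE iI privi ?eqxx.
by move/(subsetP sab); rewrite !inE privi // => /andP[/eqP].
Qed.

(** For two vertices, incomparability already provides private neighbors: each
    neighborhood has an element outside of the other. *)
Lemma incomparable_pair_irredundant P a b :
  incomparable P -> a \in P -> b \in P -> a != b -> irredundant [set a; b].
Proof.
move=> incP.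
have half x y : x \in P -> y \in P -> x != y ->
    exists2 i, i \in I & {in [set x; y], forall z, e z i = (z == x)}.
  move=> xP yP xy; have /subsetPn[i] :
      ~~ (neighbors e x :&: I \subset neighbors e y :&: I).
    by apply: contra xy => sxy; apply/eqP/incP.
  rewrite !inE => /andP[xi iI]; rewrite iI andbT => yi.
  exists i => // z /set2P[]->; first by rewrite xi eqxx.
  by rewrite (negbTE yi) eq_sym (negbTE xy).
move=> aP bP ab c /set2P[]->; first exact: half.
by rewrite setUC; apply: half; rewrite // eq_sym.
Qed.

(** A Sperner subfamily of the neighborhoods is the same as a set of
    incomparable vertices, once one vertex is chosen for each neighborhood.
    Only maximal families occur in the SP property, but private neighbors are
    inherited by subfamilies. *)
Lemma SP_splitP :
  SP_split e K I <->
  (forall P, P \subset K -> incomparable P -> irredundant P).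
Proof.
split=> [SP P sPK incP | irr F /maxsetp/andP[sFE /forall_inP spF]].
  pose F0 := [set neighbors e a :&: I | a in P].
  have spF0 : (F0 \subset [set neighbors e v :&: I | v in K]) && sperner F0.
    rewrite imsetS //=; apply/forall_inP=> _ /imsetP[a aP ->].
    apply/forall_inP=> _ /imsetP[b bP ->]; apply/implyP=> sab.
    by rewrite (incP a b).
  have [F maxF sF0F] := @maxset_exists _
    (fun F => (F \subset [set neighbors e v :&: I | v in K]) && sperner F) F0 spF0.
  have [v privv] := SP F maxF => a aP.
  have inF b : b \in P -> neighbors e b :&: I \in F.
    by move=> bP; apply: (subsetP sF0F); apply: imset_f.
  pose Na := exist (fun f => f \in F) _ (inF a aP).
  have [vI /setP priv] := privv Na; exists (v Na) => // b bP.
  move: (priv (neighbors e b :&: I)); rewrite !inE inF //= vI andbT => ->.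
  apply/eqP/eqP=> [eqN | -> //].
  by apply: incP; rewrite ?eqN.
have reprF (f : {f | f \in F}) :
    exists2 a, a \in K & neighbors e a :&: I = val f.
  by have /imsetP[a aK ->] := subsetP sFE _ (valP f); exists a.
have [r rK rN] := fin_all_exists2 reprF.
pose P := [set r f | f : {f | f \in F}].
have rP f : r f \in P by apply: imset_f.
have irrP : irredundant P.
  apply: irr; first by apply/subsetP=> _ /imsetP[f _ ->].
  move=> _ _ /imsetP[f _ ->] /imsetP[g _ ->]; rewrite !rN => sfg.
  have /forall_inP/(_ _ (valP g))/implyP/(_ sfg)/eqP := spF _ (valP f).
  by move/val_inj->.
have privf f : exists2 i, i \in I & {in P, forall b, e b i = (b == r f)}.
  exact: irrP.
have [v vI privv] := fin_all_exists2 privf.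
exists v => f; split=> //; apply/setP=> g; rewrite !inE.
have [gF|gF] := boolP (g \in F); last first.
  by apply/esym/negP=> /eqP gf; rewrite gf (valP f) in gF.
pose g' := exist (fun h => h \in F) g gF.
have gN : neighbors e (r g') :&: I = g := rN g'.
have -> : (v f \in g) = (r g' == r f).
  by rewrite -{1}gN !inE vI andbT privv.
apply/eqP/eqP=> [rgf | gf]; first by rewrite -gN rgf rN.
by congr r; apply: val_inj.
Qed.

(** * Domination of [K] by subsets of [I] *)

Lemma dominatesP S :
  S \subset I ->
  reflect {in K, forall k, exists2 i, i \in S & e k i}
          (K \subset set_neighbors e S).
Proof.
move=> sSI; apply: (iffP subsetP) => domS k kK.
  by have := domS k kK; rewrite inE => /andP[_ /exists_inP].
rewrite inE; apply/andP; split; last by apply/exists_inP/domS.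
by apply: contraTN kK => /(subsetP sSI); rewrite in_indep_part.
Qed.

Lemma not_dominatesP S :
  S \subset I ->
  reflect (exists2 k, k \in K & {in S, forall i, ~~ e k i})
          (~~ (K \subset set_neighbors e S)).
Proof.
move=> sSI; apply: (iffP idP) => [/subsetPn[k kK] | [k kK nk]].
  rewrite inE negb_and negbK => /orP[/(subsetP sSI)|].
    by rewrite in_indep_part kK.
  by rewrite negb_exists_in => /forall_inP nk; exists k.
by apply/(dominatesP sSI) => /(_ k kK)[i /nk/negP].
Qed.

(** By contraposition, the right-hand side says that each dominating set
    contains a dominating pair of distinct vertices. This gives size two for a
    minimal one; conversely, each dominating set contains a minimal one. *)
Lemma two_well_dominatedP :
  two_well_dominated e K I <->
  (forall Q, Q \subset I ->
    {in Q &, forall i j, i != j -> exists k, [/\ k \in K, ~~ e k i & ~~ e k j]} ->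
    exists2 k, k \in K & {in Q, forall i, ~~ e k i}).
Proof.
split=> [wd Q sQI pairQ | coQ S /minsetP[/andP[sSI domS] minS]].
  apply/(not_dominatesP sQI)/negP=> domQ.
  have domQI : (Q \subset I) && (K \subset set_neighbors e Q) by rewrite sQI.
  have [S minS sSQ] := @minset_exists _
    (fun S' => (S' \subset I) && (K \subset set_neighbors e S')) Q domQI.
  have /eqP/cards2P[i [j [ij eqS]]] := wd S minS.
  have /minsetp/andP[sSI /(dominatesP sSI) domS] := minS.
  have [|| k [kK ki kj]] := pairQ i j _ _ ij.
  - by apply: (subsetP sSQ); rewrite eqS !inE eqxx.
  - by apply: (subsetP sSQ); rewrite eqS !inE eqxx orbT.
  have [l] := domS k kK; rewrite eqS => /set2P[]->; exact/negP.
have [/exists_inP[i iS /exists_inP[j jS /andP[ij domij]]]|] := boolP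
  [exists i in S, exists j in S,
    (i != j) && (K \subset set_neighbors e [set i; j])].
  have sijS : [set i; j] \subset S by rewrite subUset !sub1set iS.
  by rewrite -(minS _ _ sijS) ?cards2 ?ij // domij (subset_trans sijS).
rewrite negb_exists_in => /forall_inP nodom.
exfalso.
have [|k kK nk] := coQ S sSI; last first.
  by have [i /nk/negP] := dominatesP sSI domS k kK.
move=> i j iS jS ij; have := nodom i iS.
rewrite negb_exists_in => /forall_inP/(_ j jS); rewrite ij /=.
have sijI : [set i; j] \subset I by rewrite subUset !sub1set !(subsetP sSI).
case/(not_dominatesP sijI)=> k kK nk.
by exists k; split=> //; apply: nk; rewrite !inE eqxx ?orbT.
Qed.

(** * Conformality *)

(** An incomparable set in [K] has its pairs in minimal transversals, so by
    conformality it is part of a core, which is irredundant. *)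
Lemma CDC_SP : CDC e -> SP_split e K I.
Proof.
move=> cdc; apply/SP_splitP => P sPK incP.
have [|A [[_ irrA _] sPA _]] := (extendableP P).1 _.
  apply: cdc => [|a b aP bP ab]; first exact: subsetT.
  have sabK : [set a; b] \subset K by rewrite subUset !sub1set !(subsetP sPK).
  have [|X XE sabX] := (extendableP [set a; b]).2 _.
    exists [set a; b]; split; first split=> //.
    - exact (incomparable_pair_irredundant incP aP bP ab).
    - by move=> _; apply/set0Pn; exists a; rewrite !inE eqxx.
    - exact: subsetIl.
    move=> i c; rewrite inE => /andP[/(subsetP sabK) iK].
    by rewrite in_indep_part iK.
  by exists X; rewrite // !(subsetP sabX) // !inE eqxx ?orbT.
rewrite (setIidPl sPK) in sPA => a aP.
have [i iI privi] := irrA a (subsetP sPA a aP).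
by exists i => // b /(subsetP sPA)/privi.
Qed.

(** A common non-neighbor of two vertices of [I] is a core for the pair, and
    any core for [Q] is nonempty and consists of common non-neighbors. *)
Lemma CDC_two_well_dominated :
  CDC e -> maxset (clique e) K -> two_well_dominated e K I.
Proof.
move=> cdc maxK; apply/two_well_dominatedP => Q sQI pairQ.
have [|A [[sAK _ neA] _ nadj]] := (extendableP Q).1 _; last first.
  have /set0Pn[a aA] := neA maxK; exists a; first exact: (subsetP sAK).
  by move=> i iQ; apply: nadj; rewrite // inE iQ (subsetP sQI).
apply: cdc => [|i j iQ jQ ij]; first exact: subsetT.
have [k [kK ki kj]] := pairQ i j iQ jQ ij.
have [|X XE sijX] := (extendableP [set i; j]).2 _.
  exists [set k]; split; first exact: is_core1.
    apply/subsetP=> x; rewrite !inE => /andP[/orP[]/eqP->] xK.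
      by have := subsetP sQI i iQ; rewrite in_indep_part xK.
    by have := subsetP sQI j jQ; rewrite in_indep_part xK.
  by move=> l c; rewrite !inE => /andP[/orP[]/eqP-> _] /eqP->.
by exists X; rewrite // !(subsetP sijX) // !inE eqxx ?orbT.
Qed.

(** The part [U :&: K] is incomparable, hence irredundant; it is the required
    core unless it is empty while [K] is a maximal clique. *)
Lemma SP_two_well_dominated_CDC :
  SP_split e K I -> (maxset (clique e) K -> two_well_dominated e K I) -> CDC e.
Proof.
move=> /SP_splitP irr wd U _ pairU.
have coreU a b : a \in U -> b \in U -> a != b -> exists A,
    [/\ is_core A, [set a; b] :&: K \subset A
      & {in [set a; b] :&: I & A, forall i c, ~~ e c i}].
  move=> aU bU ab; apply/extendableP; have [X XE abX] := pairU a b aU bU ab.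
  by exists X => //; rewrite subUset !sub1set.
have incU : incomparable (U :&: K).
  move=> a b /setIP[aU aK] /setIP[bU bK] sab.
  have [//|ab] := eqVneq a b.
  have [A [[_ irrA _] /subsetP sA _]] := coreU a b aU bU ab.
  by apply: (irredundant_incomparable irrA); rewrite ?sA // !inE eqxx ?orbT.
have irrU := irr _ (subsetIr U K) incU.
apply/extendableP.
have [coreUK|] := boolP (maxset (clique e) K ==> (U :&: K != set0)).
  exists (U :&: K); split=> //.
    by split; [apply: subsetIr | | apply/implyP].
  move=> i a /setIP[iU iI] /setIP[aU aK].
  have ai : a != i by apply: contraTneq aK => ->; rewrite -in_indep_part.
  have [A [_ /subsetP sA]] := coreU a i aU iU ai.
  by apply; rewrite ?sA // !inE eqxx ?orbT.
(* Here [U] lies in [I] and an empty core is excluded; a core with one vertex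
   of [K], missing all of [U], does the job. *)
rewrite negb_imply negbK => /andP[maxK /eqP UK0].
have sUI : U \subset I.
  apply/subsetP=> x xU; rewrite in_indep_part; apply/negP=> xK.
  by have := in_set0 x; rewrite -UK0 inE xU xK.
have [|k kK nk] := two_well_dominatedP.1 (wd maxK) U sUI _.
  move=> i j iU jU ij; have [A [[sAK _ neA] _ nadj]] := coreU i j iU jU ij.
  have /set0Pn[k kA] := neA maxK; exists k; split; first exact: (subsetP sAK).
    by apply: nadj; rewrite // !inE eqxx (subsetP sUI).
  by apply: nadj; rewrite // !inE eqxx orbT (subsetP sUI).
exists [set k]; split; first exact: is_core1.
  by rewrite UK0 sub0set.
by move=> i c /setIP[iU _] /set1P->; apply: nk.
Qed.

End SplitTransversals.

Theorem theorem7p5 (T : finType) (e : rel T) (K I : {set T})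
    (e_sym : symmetric e) (e_irr : irreflexive e) (T_gt0 : 0 < #|T|)
    (splitKI : split_partition e K I) (maxI : maxset (independent e) I) :
  CDC e <->
  SP_split e K I /\ (maxset (clique e) K -> two_well_dominated e K I).
Proof.
split=> [cdc | [SP wd]]; last exact: (SP_two_well_dominated_CDC e_sym e_irr splitKI).
split; first exact: (CDC_SP e_sym e_irr splitKI).
exact: (CDC_two_well_dominated e_sym e_irr splitKI).
Qed.
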